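(* Let $\mathbb{K}$ be a field. Suppose that $G$ is an infinite group and consider the connected component $\Delta$ of the groupoid $\Gamma(G)$ with unique vertex $G$. Then $\mathbb{K}\Delta$ is not projective as a left $\mathbb{K}_{par}G$-module.
   Context: $\mathbb{K}_{par}G$ is the unital associative $\mathbb{K}$-algebra generated by symbols $[g]$, $g\in G$, subject to $[g][h][h^{-1}]=[gh][h^{-1}]$, $[g^{-1}][g][h]=[g^{-1}][gh]$ and $[1]=1$ for all $g,h\in G$. $\Gamma(G)$ is the groupoid whose objects (vertices) are the subsets of $G$ containing $1$ and whose morphisms are the pairs $(A,g)$ with $A\subseteq G$ and $1,g^{-1}\in A$; $(A,g)$ is an arrow from $A$ to $gA$, and $(gA,g')\circ(A,g)=(A,g'g)$. For a connected component $\Delta$, $\mathcal{V}_\Delta$ is its set of vertices, and $\mathbb{K}\Delta$ is the groupoid algebra (basis: the morphisms of $\Delta$; product is composition when defined and $0$ otherwise). When $\mathcal{V}_\Delta$ is finite there is an algebra homomorphism $\lambda_\Delta:\mathbb{K}_{par}G\to\mathbb{K}\Delta$, $\lambda_\Delta([g])=\sum_{C\in\mathcal{V}_\Delta,\ g^{-1}\in C}(C,g)$, and $\mathbb{K}\Delta$ is viewed as a left $\mathbb{K}_{par}G$-module via $[g]\cdot a=\lambda_\Delta([g])a$. (For the component with unique vertex $G$, $\mathbb{K}\Delta$ is the group algebra $\mathbb{K}G$ with $(G,g)$ identified with $g$, and $\lambda_\Delta([g])=g$.) *)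

(* Defs.v *)
From HB Require Import structures.
From mathcomp Require Import all_boot all_order all_algebra.
From mathcomp Require Import boolp classical_sets functions cardinality fsbigop.
From mathcomp Require Import finmap monalg.

Set Implicit Arguments.
Unset Strict Implicit.
Unset Printing Implicit Defensive.

Import GRing.Theory Quotient.

Local Open Scope classical_set_scope.
Local Open Scope ring_scope.
Local Open Scope quotient_scope.

Definition projective (R : pzRingType) (M : lmodType R) : Prop :=
  forall (N P : lmodType R) (p : {linear N -> P}) (f : {linear M -> P}),
    (forall y, exists x, p x = y) ->
    exists f' : {linear M -> N}, forall m, p (f' m) = f m.

Definition two_sided_ideal (R : pzRingType) (I : set R) : Prop :=
  [/\ I 0, forall x y, I x -> I y -> I (x - y)
    & forall a x b, I x -> I (a * x * b)].

Section PartialGroupAlgebra.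
Context (K : fieldType) (G : groupType).

(* The free unital associative K-algebra on G: the monoid algebra of the free
   monoid on G. *)
Definition free_algebra := {malg K[{fmonom G}]}.

HB.instance Definition _ := GRing.Lalgebra.on free_algebra.

Definition free_gen (g : G) : free_algebra := << fmu g >>.

Definition par_relators : set free_algebra :=
  [set x | exists g h : G, x = free_gen g * free_gen h * free_gen h^-1%g
                             - free_gen (g * h)%g * free_gen h^-1%g]
  `|` [set x | exists g h : G, x = free_gen g^-1%g * free_gen g * free_gen h
                             - free_gen g^-1%g * free_gen (g * h)%g]
  `|` [set free_gen 1%g - 1].

Definition par_ideal : {pred free_algebra} :=
  fun x => `[< smallest (@two_sided_ideal free_algebra) par_relators x >].

Lemma par_ideal_two_sided : two_sided_ideal [set x | x \in par_ideal].
Proof.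
split=> [|x y|a x b]; rewrite ?inE /= /par_ideal.
- by apply/asboolP => J [[]].
- move=> /asboolP hx /asboolP hy; apply/asboolP => J hJ.
  by case: (hJ) => -[_ hB _] _; apply: hB; [apply: hx|apply: hy].
- move=> /asboolP hx; apply/asboolP => J hJ.
  by case: (hJ) => -[_ _ hM] _; apply: hM; apply: hx.
Qed.

Lemma par_ideal_zmod_closed : zmod_closed par_ideal.
Proof. by have [h0 hB _] := par_ideal_two_sided; split. Qed.

HB.instance Definition _ :=
  GRing.isZmodClosed.Build free_algebra par_ideal par_ideal_zmod_closed.

Lemma par_idealM a b x : x \in par_ideal -> a * x * b \in par_ideal.
Proof. by have [_ _ h] := par_ideal_two_sided; apply: h. Qed.

Lemma par_ideal_gen x : par_relators x -> x \in par_ideal.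
Proof. by move=> hx; apply/asboolP; apply: sub_gen_smallest. Qed.

Lemma free_scalerAr c (x y : free_algebra) : c *: (x * y) = x * (c *: y).
Proof.
apply/malgP => k; rewrite mcoeffZ mcoeffMl.
rewrite (mcoeffMlw _ (fsubset_refl _) (msuppZ_le _ _)) mulr_sumr.
apply: eq_bigr => i _; rewrite mulr_sumr; apply: eq_bigr => j _.
by rewrite mcoeffZ mulrnAr mulrCA.
Qed.

Definition par_algebra := {quot par_ideal}.

HB.instance Definition _ := GRing.Zmodule.on par_algebra.
HB.instance Definition _ := EqQuotient.on par_algebra.

Definition par_pi (x : free_algebra) : par_algebra := \pi_par_algebra x.

Lemma par_piE x y : (par_pi x = par_pi y) <-> x - y \in par_ideal.
Proof. by rewrite (idealrBE par_ideal); split=> /eqP. Qed.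

Lemma par_pi_surj (u : par_algebra) : exists x, u = par_pi x.
Proof. by exists (repr u); rewrite /par_pi reprK. Qed.

Lemma par_piB : {morph par_pi : x y / x - y}.
Proof. by move=> x y; rewrite /par_pi !piE. Qed.

Lemma par_piD : {morph par_pi : x y / x + y}.
Proof. by move=> x y; rewrite /par_pi !piE. Qed.

Definition par_one : par_algebra := par_pi 1.
Definition par_mul (u v : par_algebra) : par_algebra :=
  par_pi (repr u * repr v).
Definition par_scale (c : K) (u : par_algebra) : par_algebra :=
  par_pi (c *: repr u).

Lemma par_pi_repr x : x - repr (par_pi x) \in par_ideal.
Proof. by apply/par_piE; rewrite /par_pi reprK. Qed.

Lemma par_piM : {morph par_pi : x y / x * y >-> par_mul x y}.
Proof.
move=> x y; apply/par_piE; set x' := repr _; set y' := repr _.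
have -> : x * y - x' * y' = 1 * (x - x') * y + x' * (y - y') * 1.
  by rewrite mul1r mulr1 mulrBl mulrBr addrA subrK.
by rewrite rpredD ?par_idealM ?par_pi_repr.
Qed.

Lemma par_piZ c : {morph par_pi : x / c *: x >-> par_scale c x}.
Proof.
move=> x; apply/par_piE.
by rewrite -scalerBr -mul_malgC -[_ * _]mulr1 par_idealM ?par_pi_repr.
Qed.

Fact par_mulA : associative par_mul.
Proof.
move=> u v w; have [x ->] := par_pi_surj u; have [y ->] := par_pi_surj v.
by have [z ->] := par_pi_surj w; rewrite -!par_piM mulrA.
Qed.

Fact par_mul1r : left_id par_one par_mul.
Proof.
by move=> u; have [x ->] := par_pi_surj u; rewrite -par_piM mul1r.
Qed.

Fact par_mulr1 : right_id par_one par_mul.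
Proof.
by move=> u; have [x ->] := par_pi_surj u; rewrite -par_piM mulr1.
Qed.

Fact par_mulDl : left_distributive par_mul +%R.
Proof.
move=> u v w; have [x ->] := par_pi_surj u; have [y ->] := par_pi_surj v.
by have [z ->] := par_pi_surj w; rewrite -par_piD -!par_piM -par_piD mulrDl.
Qed.

Fact par_mulDr : right_distributive par_mul +%R.
Proof.
move=> u v w; have [x ->] := par_pi_surj u; have [y ->] := par_pi_surj v.
by have [z ->] := par_pi_surj w; rewrite -par_piD -!par_piM -par_piD mulrDr.
Qed.

Definition partial_representation (A : pzRingType) (phi : G -> A) : Prop :=
  [/\ forall g h, phi g * phi h * phi h^-1%g = phi (g * h)%g * phi h^-1%g,
      forall g h, phi g^-1%g * phi g * phi h = phi g^-1%g * phi (g * h)%g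
    & phi 1%g = 1].

Section FreeEval.
Context (A : algType K) (phi : G -> A).

Definition word_eval (m : {fmonom G}) : A := \prod_(g <- (m : seq G)) phi g.

Fact word_eval_mmorphism : mmorphism word_eval.
Proof.
split=> [m1 m2|]; rewrite /word_eval; first by rewrite fmM big_cat.
by rewrite fm1 big_nil.
Qed.

HB.instance Definition _ :=
  isMultiplicative.Build {fmonom G} A word_eval word_eval_mmorphism.

Definition free_eval (x : free_algebra) : A :=
  mmap (GRing.in_alg A) word_eval x.

Lemma free_evalD : {morph free_eval : x y / x + y}.
Proof. exact: mmapD. Qed.

Lemma free_evalB : {morph free_eval : x y / x - y}.
Proof. exact: mmapB. Qed.

Fact free_eval_mult : multiplicative free_eval.
Proof.
apply: commr_mmap_is_multiplicative => g m m' /=.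
by rewrite /GRing.comm mulr_algl mulr_algr.
Qed.

Lemma free_evalM : {morph free_eval : x y / x * y}.
Proof. exact: free_eval_mult.1. Qed.

Lemma free_eval1 : free_eval 1 = 1.
Proof. exact: free_eval_mult.2. Qed.

Lemma free_evalZ c x : free_eval (c *: x) = c *: free_eval x.
Proof. by rewrite /free_eval mmapZ /= mulr_algl. Qed.

Lemma free_eval_gen g : free_eval (free_gen g) = phi g.
Proof.
by rewrite /free_eval mmapU /= scale1r mul1r /word_eval fmU big_seq1.
Qed.

Lemma free_eval_ideal x :
  partial_representation phi -> x \in par_ideal -> free_eval x = 0.
Proof.
move=> [h1 h2 h3] /asboolP /(_ [set x | free_eval x = 0]); apply; split.
  split=> /= [|y z hy hz|a y b hy].
  - by rewrite /free_eval mmap0.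
  - by rewrite free_evalB hy hz subrr.
  - by rewrite !free_evalM hy mulr0 mul0r.
have ev (a b c d e : free_algebra) : free_eval (a * b * c - d * e) =
    free_eval a * free_eval b * free_eval c
    - free_eval d * free_eval e by rewrite free_evalB !free_evalM.
move=> y hy; suff : free_eval y = 0 by [].
case: hy => [[|]|] => [[g [h ->]]|[g [h ->]]|->].
- by rewrite ev !free_eval_gen h1 subrr.
- by rewrite ev !free_eval_gen h2 subrr.
- by rewrite free_evalB free_eval_gen free_eval1 h3 subrr.
Qed.
End FreeEval.

Fact par_one_neq0 : par_one != 0.
Proof.
have h0 : par_pi 0 = 0 by rewrite -(subrr 0) par_piB subrr.
rewrite -h0; apply/eqP => /par_piE; rewrite subr0.
have hphi : partial_representation (fun=> 1 : K^o).
  by split=> // *; rewrite !mulr1.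
move=> /(free_eval_ideal hphi) /eqP.
by rewrite free_eval1 oner_eq0.
Qed.

HB.instance Definition _ := GRing.Zmodule_isNzRing.Build par_algebra
  par_mulA par_mul1r par_mulr1 par_mulDl par_mulDr par_one_neq0.

Fact par_scalerA a b u : par_scale a (par_scale b u) = par_scale (a * b) u.
Proof.
by have [x ->] := par_pi_surj u; rewrite -!par_piZ scalerA.
Qed.

Fact par_scale1r : left_id 1 par_scale.
Proof. by move=> u; have [x ->] := par_pi_surj u; rewrite -par_piZ scale1r. Qed.

Fact par_scalerDr : right_distributive par_scale +%R.
Proof.
move=> c u v; have [x ->] := par_pi_surj u; have [y ->] := par_pi_surj v.
by rewrite -par_piD -!par_piZ -par_piD scalerDr.
Qed.

Fact par_scalerDl u : {morph par_scale^~ u : a b / a + b}.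
Proof.
by move=> a b; have [x ->] := par_pi_surj u; rewrite -!par_piZ -par_piD scalerDl.
Qed.

HB.instance Definition _ := GRing.Zmodule_isLmodule.Build K par_algebra
  par_scalerA par_scale1r par_scalerDr par_scalerDl.

Fact par_scalerAl (c : K) (u v : par_algebra) : c *: (u * v) = (c *: u) * v.
Proof.
have [x ->] := par_pi_surj u; have [y ->] := par_pi_surj v.
change (par_scale c (par_mul (par_pi x) (par_pi y)) =
        par_mul (par_scale c (par_pi x)) (par_pi y)).
by rewrite -par_piZ -!par_piM -par_piZ scalerAl.
Qed.

HB.instance Definition _ :=
  GRing.Lmodule_isLalgebra.Build K par_algebra par_scalerAl.

Fact par_scalerAr (c : K) (u v : par_algebra) : c *: (u * v) = u * (c *: v).
Proof.
have [x ->] := par_pi_surj u; have [y ->] := par_pi_surj v.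
change (par_scale c (par_mul (par_pi x) (par_pi y)) =
        par_mul (par_pi x) (par_scale c (par_pi y))).
by rewrite -par_piZ -!par_piM -par_piZ free_scalerAr.
Qed.

HB.instance Definition _ :=
  GRing.Lalgebra_isAlgebra.Build K par_algebra par_scalerAr.

Definition par_gen (g : G) : par_algebra := par_pi (free_gen g).

Lemma par_gen_par_rep : partial_representation par_gen.
Proof.
split=> [g h|g h|].
- change (par_mul (par_mul (par_gen g) (par_gen h)) (par_gen h^-1%g)
    = par_mul (par_gen (g * h)%g) (par_gen h^-1%g)).
  rewrite /par_gen -!par_piM.
  apply/par_piE.
  apply: par_ideal_gen.
  left; left.
  by exists g, h.
- change (par_mul (par_mul (par_gen g^-1%g) (par_gen g)) (par_gen h)
    = par_mul (par_gen g^-1%g) (par_gen (g * h)%g)).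
  rewrite /par_gen -!par_piM; apply/par_piE; apply: par_ideal_gen.
  by left; right; exists g, h.
- by apply/par_piE; apply: par_ideal_gen; right.
Qed.

Section Lift.
Context (A : algType K) (phi : G -> A) (hphi : partial_representation phi).

Definition par_lift of partial_representation phi :=
  fun u : par_algebra => free_eval phi (repr u).

Lemma par_lift_pi x : par_lift hphi (par_pi x) = free_eval phi x.
Proof.
apply/eqP; rewrite eq_sym -subr_eq0 -free_evalB.
by apply/eqP/(free_eval_ideal hphi)/par_pi_repr.
Qed.

Fact par_lift_zmod_morphism : zmod_morphism (par_lift hphi).
Proof.
move=> u v; have [x ->] := par_pi_surj u; have [y ->] := par_pi_surj v.
by rewrite -par_piB !par_lift_pi free_evalB.
Qed.

HB.instance Definition _ := GRing.isZmodMorphism.Build par_algebra A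
  (par_lift hphi) par_lift_zmod_morphism.

Fact par_lift_monoid_morphism : monoid_morphism (par_lift hphi).
Proof.
split=> [|u v]; first by rewrite par_lift_pi free_eval1.
have [x ->] := par_pi_surj u; have [y ->] := par_pi_surj v.
rewrite -[_ * _]/(par_mul _ _) -par_piM !par_lift_pi; exact: free_evalM.
Qed.

HB.instance Definition _ := GRing.isMonoidMorphism.Build par_algebra A
  (par_lift hphi) par_lift_monoid_morphism.

Fact par_lift_scalable : scalable (par_lift hphi).
Proof.
move=> c u; have [x ->] := par_pi_surj u.
rewrite -[_ *: par_pi x]/(par_scale _ _) -par_piZ !par_lift_pi; exact: free_evalZ.
Qed.

HB.instance Definition _ := GRing.isScalable.Build K par_algebra A *:%R
  (par_lift hphi) par_lift_scalable.

Lemma par_lift_gen g : par_lift hphi (par_gen g) = phi g.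
Proof. by rewrite par_lift_pi free_eval_gen. Qed.
End Lift.
End PartialGroupAlgebra.

Arguments par_gen K G g : clear implicits.

Section Groupoid.
Context (G : groupType).
Implicit Types (A B : set G) (p q : set G * G).

(* The vertices of Gamma(G) are the subsets of G containing 1; its arrows are
   pairs (A, g) with 1 and g^-1 in A, going from A to gA. *)
Definition is_vertex A : Prop := A 1%g.
Definition is_arrow p : Prop := p.1 1%g /\ p.1 p.2^-1%g.
Definition source p : set G := p.1.
Definition target p : set G := [set (p.2 * x)%g | x in p.1].

Definition connected A B : Prop :=
  exists p, [/\ is_arrow p, source p = A & target p = B].

Lemma targetE p x : target p x <-> p.1 (p.2^-1 * x)%g.
Proof.
split=> [[y hy <-]|hx]; first by rewrite mulKg.
by exists (p.2^-1 * x)%g => //; rewrite mulVKg.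
Qed.

Lemma target_vertex p : is_arrow p -> is_vertex (target p).
Proof. by case=> _ hp; apply/targetE; rewrite mulg1. Qed.

Lemma target_comp A g h :
  target (target (A, g), h) = target (A, (h * g)%g).
Proof.
by apply/seteqP; split=> x; rewrite !targetE /= !targetE /= invgM mulgA.
Qed.

Lemma arrow_comp A g h :
  is_arrow (A, g) -> is_arrow (target (A, g), h) -> is_arrow (A, (h * g)%g).
Proof.
move=> [/= h1 hg] [/= _ /targetE /= hh].
by split; rewrite //= invgM.
Qed.

Lemma target1 A : target (A, 1%g) = A.
Proof. by apply/seteqP; split=> x; rewrite targetE /= invg1 mul1g. Qed.

Lemma arrow1 A : is_vertex A -> is_arrow (A, 1%g).
Proof. by split; rewrite //= invg1. Qed.

Lemma connected_refl A : is_vertex A -> connected A A.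
Proof. by exists (A, 1%g); split; [exact: arrow1| |exact: target1]. Qed.

Lemma connected_trans A B C : connected A B -> connected B C -> connected A C.
Proof.
case=> -[A' g] [hp <- <-] [[B' h] [hq hB <-]].
rewrite /source /= in hB; rewrite hB in hq *.
by exists (A', (h * g)%g); split; rewrite ?target_comp //; apply: arrow_comp.
Qed.

Lemma connected_sym A B : connected A B -> connected B A.
Proof.
case=> -[A' g] [[/= h1 hg] <- <-]; exists (target (A', g), g^-1%g).
split=> //; last by rewrite target_comp mulVg target1.
by split; apply/targetE; rewrite /= ?mulg1 // invgK mulVg.
Qed.

(* A connected component, given by its set of vertices. *)
Record component := Component {
  vertices :> set (set G);
  _ : exists2 A, is_vertex A & vertices = [set B | connected A B]
}.

Record fin_component := FinComponent {
  fin_component_val :> component;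
  finite_vertices : finite_set (vertices fin_component_val)
}.

Section Component.
Context (Delta : component).

Lemma component_nonempty : exists2 A, is_vertex A & vertices Delta A.
Proof.
case: Delta => V /= [A hA ->]; exists A => //; exact: connected_refl.
Qed.

Lemma component_target p :
  is_arrow p -> vertices Delta (source p) -> vertices Delta (target p).
Proof.
case: Delta => V /= [A hA ->] hp /= h.
by apply: connected_trans h _; exists p.
Qed.

Lemma component_source p :
  is_arrow p -> vertices Delta (target p) -> vertices Delta (source p).
Proof.
case: Delta => V /= [A hA ->] hp /= h.
by apply: connected_trans h _; apply: connected_sym; exists p.
Qed.

Lemma component_vertex A : vertices Delta A -> is_vertex A.
Proof.
case: Delta => V /= [B hB ->] [p [hp _ <-]]; exact: target_vertex.
Qed.

Definition is_component_arrow : pred (set G * G) :=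
  fun p => `[< is_arrow p /\ vertices Delta (source p) >].

Definition arrow := {p : set G * G | is_component_arrow p}.

HB.instance Definition _ := Choice.on arrow.
HB.instance Definition _ := SubType.on arrow.

Lemma arrowP (a : arrow) : is_arrow (val a) /\ vertices Delta (source (val a)).
Proof. exact/asboolP/(valP a). Qed.

(* Composition a o b, defined when b ends where a starts; the pair passed to
   insub is then always an arrow (compose_composable). *)
Definition compose (a b : arrow) : option arrow :=
  if source (val a) == target (val b)
  then insub (source (val b), ((val a).2 * (val b).2)%g) else None.

Lemma compose_composable (a b : arrow) : source (val a) = target (val b) ->
  exists2 c, compose a b = Some c &
             val c = (source (val b), ((val a).2 * (val b).2)%g).
Proof.
move=> e; rewrite /compose e eqxx.
have hc : is_component_arrow (source (val b), ((val a).2 * (val b).2)%g).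
  case: a b e => -[A g] /= ha [[B h] /= hb] /= e; apply/asboolP.
  move: ha hb => /asboolP [ha hA] /asboolP [hb hB]; split=> //.
  by apply: arrow_comp => //; rewrite -[target _]e.
by exists (Sub _ hc); rewrite ?(insubT is_component_arrow hc) // SubK.
Qed.

Lemma compose_Some (a b c : arrow) : compose a b = Some c ->
  source (val a) = target (val b) /\
  val c = (source (val b), ((val a).2 * (val b).2)%g).
Proof.
move=> h; case: (eqVneq (source (val a)) (target (val b))) => e.
  by have [c' h' <-] := compose_composable e; rewrite h in h'; case: h' => ->.
by move: h; rewrite /compose (negbTE e).
Qed.

Lemma composeA (a b c : arrow) :
  obind (compose a) (compose b c) = obind (compose^~ c) (compose a b).
Proof.
have tgt (x y z : arrow) : compose x y = Some z -> target (val z) = target (val x).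
  case/compose_Some => e ->; case: x y e => -[A g] /= ? [[B h] /= ?] /= e.
  by rewrite -target_comp -e.
have src (x y z : arrow) : compose x y = Some z -> source (val z) = source (val y).
  by case/compose_Some => _ ->.
have val2 (x y z : arrow) : compose x y = Some z ->
  (val z).2 = ((val x).2 * (val y).2)%g by case/compose_Some => _ ->.
case ebc: (compose b c) => [d|]; case eab: (compose a b) => [e|] //=.
- have [hab _] := compose_Some eab; have [hbc _] := compose_Some ebc.
  have [f1 -> v1] := compose_composable (etrans hab (esym (tgt _ _ _ ebc))).
  have [f2 -> v2] := compose_composable (etrans (src _ _ _ eab) hbc).
  congr Some; apply: val_inj.
  by rewrite v1 v2 (src _ _ _ ebc) (val2 _ _ _ ebc) (val2 _ _ _ eab) mulgA.
- case ead: (compose a d) => [f|] //=.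
  have [h _] := compose_Some ead; rewrite (tgt _ _ _ ebc) in h.
  by have [? h' _] := compose_composable h; rewrite eab in h'.
- case eec: (compose e c) => [f|] //=.
  have [h _] := compose_Some eec; rewrite (src _ _ _ eab) in h.
  by have [? h' _] := compose_composable h; rewrite ebc in h'.
Qed.
End Component.

Fact full_component_subproof :
  exists2 A, is_vertex A & [set setT] = [set B | connected A B].
Proof.
exists setT => //; apply/seteqP; split=> [_ ->|B [[A g] [_ /= -> <-]]] /=.
  exact: connected_refl.
by apply/seteqP; split=> // x _; apply/targetE.
Qed.

Definition full_component : fin_component :=
  @FinComponent (Component full_component_subproof) (finite_set1 _).

End Groupoid.

Arguments vertices {G}.

Lemma malg_linear_ext (K : fieldType) (T : choiceType) (V : lmodType K)
    (f g : {malg K[T]} -> V) :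
  linear f -> linear g -> (forall a, f << a >> = g << a >>) -> f =1 g.
Proof.
move=> hf hg h x.
have f0 : f 0 = 0 by have := hf (-1) 0 0; rewrite scaler0 addr0 scaleN1r addNr.
have g0 : g 0 = 0 by have := hg (-1) 0 0; rewrite scaler0 addr0 scaleN1r addNr.
rewrite [x]monalgE; elim/big_ind: _ => [|y z hy hz|a _].
- by rewrite f0 g0.
- by rewrite -[y]scale1r hf hg !scale1r hy hz.
- have -> : << x@_a *g a >> = x@_a *: << a >> + 0 :> {malg K[T]}.
    by apply/malgP => k; rewrite addr0 mcoeffZ !mcoeffU mulrnAr mulr1.
  by rewrite hf hg h f0 g0.
Qed.

Section GroupoidAlgebra.
Context (K : fieldType) (G : groupType) (Delta : component G).

Definition groupoid_algebra := {malg K[arrow Delta]}.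

HB.instance Definition _ := GRing.Lmodule.on groupoid_algebra.

Implicit Types (a b c : arrow Delta) (x y z : groupoid_algebra).

Definition arrow_mul a b : groupoid_algebra :=
  if compose a b is Some c then << c >> else 0.

Definition groupoid_mul x y : groupoid_algebra :=
  \sum_(a <- msupp x) \sum_(b <- msupp y) (x@_a * y@_b) *: arrow_mul a b.

Lemma groupoid_mulw (d1 d2 : {fset arrow Delta}) x y :
  (msupp x `<=` d1)%fset -> (msupp y `<=` d2)%fset ->
  groupoid_mul x y =
  \sum_(a <- d1) \sum_(b <- d2) (x@_a * y@_b) *: arrow_mul a b.
Proof.
move=> h1 h2; rewrite /groupoid_mul (big_fset_incl _ h1) /=.
  apply: eq_bigr => a _; apply: big_fset_incl => // b _ /mcoeff_outdom ->.
  by rewrite mulr0 scale0r.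
move=> a _ /mcoeff_outdom e; rewrite big1 // => b _.
by rewrite e mul0r scale0r.
Qed.

Lemma groupoid_mulUU a b : groupoid_mul << a >> << b >> = arrow_mul a b.
Proof.
rewrite (groupoid_mulw msuppU_le msuppU_le) !big_seq_fset1 !mcoeffUU.
by rewrite mulr1 scale1r.
Qed.

Lemma groupoid_mul_linear_r x : linear (groupoid_mul x).
Proof.
move=> k y z.
set d := (msupp y `|` msupp z)%fset.
have hy : (msupp y `<=` d)%fset by exact: fsubsetUl.
have hz : (msupp z `<=` d)%fset by exact: fsubsetUr.
have hyz : (msupp (k *: y + z) `<=` d)%fset.
  apply: fsubset_trans (msuppD_le _ _) _.
  by rewrite fsubUset hz andbT; apply: fsubset_trans (msuppZ_le _ _) hy.
rewrite !(groupoid_mulw (fsubset_refl _) hy, groupoid_mulw (fsubset_refl _) hz,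
  groupoid_mulw (fsubset_refl _) hyz).
rewrite scaler_sumr -big_split; apply: eq_bigr => a _ /=.
rewrite scaler_sumr -big_split; apply: eq_bigr => b _ /=.
by rewrite mcoeffD mcoeffZ scalerA -scalerDl mulrDr mulrCA.
Qed.

Lemma groupoid_mul_linear_l y : linear (groupoid_mul^~ y).
Proof.
move=> k x z /=.
set d := (msupp x `|` msupp z)%fset.
have hx : (msupp x `<=` d)%fset by exact: fsubsetUl.
have hz : (msupp z `<=` d)%fset by exact: fsubsetUr.
have hxz : (msupp (k *: x + z) `<=` d)%fset.
  apply: fsubset_trans (msuppD_le _ _) _.
  by rewrite fsubUset hz andbT; apply: fsubset_trans (msuppZ_le _ _) hx.
rewrite (groupoid_mulw hx (fsubset_refl _)) (groupoid_mulw hz (fsubset_refl _)).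
rewrite (groupoid_mulw hxz (fsubset_refl _)).
rewrite scaler_sumr -big_split; apply: eq_bigr => a _ /=.
rewrite scaler_sumr -big_split; apply: eq_bigr => b _ /=.
by rewrite mcoeffD mcoeffZ scalerA -scalerDl mulrDl mulrA.
Qed.

Lemma groupoid_mulx0 x : groupoid_mul x 0 = 0.
Proof. by rewrite /groupoid_mul big1 // => a _; rewrite msupp0 big_seq_fset0. Qed.

Lemma groupoid_mul0x x : groupoid_mul 0 x = 0.
Proof. by rewrite /groupoid_mul msupp0 big_seq_fset0. Qed.

Fact groupoid_mulDl : left_distributive groupoid_mul +%R.
Proof.
by move=> x y z; rewrite -[x]scale1r groupoid_mul_linear_l !scale1r.
Qed.

Fact groupoid_mulDr : right_distributive groupoid_mul +%R.
Proof.
by move=> x y z; rewrite -[y]scale1r groupoid_mul_linear_r !scale1r.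
Qed.

Lemma groupoid_mulZl k x y : groupoid_mul (k *: x) y = k *: groupoid_mul x y.
Proof.
rewrite (groupoid_mulw (msuppZ_le k x) (fsubset_refl _)) /groupoid_mul.
rewrite scaler_sumr; apply: eq_bigr => a _.
rewrite scaler_sumr; apply: eq_bigr => b _.
by rewrite mcoeffZ scalerA mulrA.
Qed.

Lemma groupoid_mulZr k x y : groupoid_mul x (k *: y) = k *: groupoid_mul x y.
Proof.
rewrite (groupoid_mulw (fsubset_refl _) (msuppZ_le k y)) /groupoid_mul.
rewrite scaler_sumr; apply: eq_bigr => a _.
rewrite scaler_sumr; apply: eq_bigr => b _.
by rewrite mcoeffZ scalerA mulrCA.
Qed.

Fact groupoid_mulA : associative groupoid_mul.
Proof.
pose m := groupoid_mul.
have L u : linear (m u) := groupoid_mul_linear_r u.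
have R u : linear (m^~ u) := groupoid_mul_linear_l u.
have S1 y z : (forall a, m << a >> (m y z) = m (m << a >> y) z) ->
    forall x, m x (m y z) = m (m x y) z.
  by apply: malg_linear_ext => k u v; rewrite !R.
have S2 x z : (forall b, m x (m << b >> z) = m (m x << b >>) z) ->
    forall y, m x (m y z) = m (m x y) z.
  apply: (malg_linear_ext (f := fun y => m x (m y z))
    (g := fun y => m (m x y) z)) => k u v; first by rewrite R L.
  by rewrite L R.
have S3 x y : (forall c, m x (m y << c >>) = m (m x y) << c >>) ->
    forall z, m x (m y z) = m (m x y) z.
  apply: (malg_linear_ext (f := fun z => m x (m y z))
    (g := m (m x y))) => k u v; first by rewrite !L.
  by rewrite L.
move=> x y z; apply: S1 => a; apply: S2 => b; apply: S3 => c.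
rewrite /m.
have hr (o : option (arrow Delta)) :
    groupoid_mul << a >> (if o is Some d then << d >> else 0) =
    if obind (compose a) o is Some d then << d >> else 0.
  by case: o => [d|]; rewrite ?groupoid_mulUU ?groupoid_mulx0.
have hl (o : option (arrow Delta)) :
    groupoid_mul (if o is Some d then << d >> else 0) << c >> =
    if obind ((@compose _ _)^~ c) o is Some d then << d >> else 0.
  by case: o => [d|]; rewrite ?groupoid_mulUU ?groupoid_mul0x.
have e1 := congr1 (groupoid_mul << a >>) (groupoid_mulUU b c).
have e2 := congr1 (groupoid_mul^~ << c >>) (groupoid_mulUU a b).
apply: etrans (etrans e1 (hr _)) _; apply: etrans _ (esym (etrans e2 (hl _))).
by rewrite composeA.
Qed.

(* The pair p as a basis element; 0 when p is not an arrow of Delta. *)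
Definition basis_elt (p : set G * G) : groupoid_algebra :=
  if insub p is Some a then << a : arrow Delta >> else 0.

Lemma basis_eltT (p : set G * G) (a : arrow Delta) :
  val a = p -> basis_elt p = << a >>.
Proof. by move=> <-; rewrite /basis_elt valK. Qed.

Lemma basis_elt_ex A g : vertices Delta A -> A g^-1%g ->
  exists a : arrow Delta, val a = (A, g).
Proof.
move=> hA hg; have h : is_component_arrow Delta (A, g).
  by apply/asboolP; split=> //; split=> //; exact: (component_vertex hA).
by exists (Sub _ h); rewrite SubK.
Qed.

Lemma basis_eltM C g D h : vertices Delta C -> C g^-1%g ->
  vertices Delta D -> D h^-1%g ->
  groupoid_mul (basis_elt (C, g)) (basis_elt (D, h)) =
  if `[< C = target (D, h) >] then basis_elt (D, (g * h)%g) else 0.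
Proof.
move=> hC hg hD hh; have [a ea] := basis_elt_ex hC hg.
have [b eb] := basis_elt_ex hD hh.
rewrite (basis_eltT ea) (basis_eltT eb) groupoid_mulUU /arrow_mul.
case: asboolP => e.
  have e' : source (val a) = target (val b) by rewrite ea eb.
  have [c -> ec] := compose_composable e'.
  by rewrite -(basis_eltT ec) ea eb.
by rewrite /compose ea eb /source /=; case: eqP.
Qed.
End GroupoidAlgebra.

Section Lambda.
Context (K : fieldType) (G : groupType) (Delta : fin_component G).

Local Notation KD := (groupoid_algebra K Delta).
Local Notation bas := (@basis_elt K G Delta).
Implicit Types (P : set G -> Prop) (x y : KD).

Definition groupoid_one : KD :=
  \sum_(A \in vertices Delta) basis_elt K Delta (A, 1%g).

Definition lambda_gen (g : G) : KD :=
  \sum_(C \in [set C | vertices Delta C /\ C g^-1%g]) basis_elt K Delta (C, g).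

Let E P g : KD := \sum_(C \in [set C | vertices Delta C /\ C g^-1%g /\ P C])
  bas (C, g).

Let finE (S : set (set G)) : S `<=` vertices Delta -> finite_set S.
Proof. by move=> h; apply: sub_finite_set h (finite_vertices Delta). Qed.

Let lambda_genE g : lambda_gen g = E (fun=> True) g.
Proof.
by congr (\sum_(C \in _) _); apply/seteqP; split=> C /= [] // ? [].
Qed.

Let eqE P Q g : (forall C, vertices Delta C -> C g^-1%g -> P C <-> Q C) ->
  E P g = E Q g.
Proof.
move=> h; congr (\sum_(C \in _) _).
by apply/seteqP; split=> C /= [hC [hg hP]]; do !split=> //; apply/h.
Qed.

Let sum_delta (S : set (set G)) (F : set G -> KD) D :
  \sum_(C \in S) (if `[< C = D >] then F C else 0) =
  if `[< S D >] then F D else 0.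
Proof.
case: asboolP => hD.
  rewrite -(fsbig_widen [set D] S) ?fsbig_set1 ?asboolT // => [_ -> //|].
  by move=> C [_ /= ne]; rewrite asboolF.
by rewrite fsbig1 // => C hC; case: asboolP => // e; rewrite -e in hD.
Qed.

Let mul_suml (S : set (set G)) (F : set G -> KD) y : finite_set S ->
  groupoid_mul (\sum_(C \in S) F C) y = \sum_(C \in S) groupoid_mul (F C) y.
Proof.
move=> finS; rewrite !fsbig_finite //=.
elim: (finmap.enum_fset _) => [|C r IH]; first by rewrite !big_nil groupoid_mul0x.
by rewrite !big_cons groupoid_mulDl IH.
Qed.

Let mul_sumr (S : set (set G)) (F : set G -> KD) y : finite_set S ->
  groupoid_mul y (\sum_(C \in S) F C) = \sum_(C \in S) groupoid_mul y (F C).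
Proof.
move=> finS; rewrite !fsbig_finite //=.
elim: (finmap.enum_fset _) => [|C r IH]; first by rewrite !big_nil groupoid_mulx0.
by rewrite !big_cons groupoid_mulDr IH.
Qed.

Let lambda_bas g D h : vertices Delta D -> D h^-1%g ->
  groupoid_mul (lambda_gen g) (bas (D, h)) =
  if `[< D (g * h)^-1%g >] then bas (D, (g * h)%g) else 0.
Proof.
move=> hD hh; rewrite /lambda_gen mul_suml; last by apply: finE => C [].
transitivity (\sum_(C \in [set C | vertices Delta C /\ C g^-1%g])
  (if `[< C = target (D, h) >] then bas (D, (g * h)%g) else 0)).
  by apply: eq_fsbigr => C /set_mem [hC hg]; rewrite basis_eltM.
rewrite (sum_delta _ (fun=> bas (D, (g * h)%g))).
congr (if _ then _ else _); apply/asbool_equiv_eq; split=> /=.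
  by move=> [_ /targetE]; rewrite invgM.
move=> hgh; split; last by apply/targetE; rewrite /= -invgM.
apply: component_target => //; split=> //=; exact: component_vertex hD.
Qed.

Let lambdaE g P h : groupoid_mul (lambda_gen g) (E P h) =
  E (fun C => C h^-1%g /\ P C) (g * h)%g.
Proof.
rewrite /E mul_sumr; last by apply: finE => C [].
transitivity (\sum_(C \in [set C | vertices Delta C /\ C h^-1%g /\ P C])
  (if `[< C (g * h)^-1%g >] then bas (C, (g * h)%g) else 0)).
  by apply: eq_fsbigr => C /set_mem [hC [hh _]]; rewrite lambda_bas.
rewrite -(fsbig_widen [set C | vertices Delta C /\
  C (g * h)^-1%g /\ C h^-1%g /\ P C]).
- by apply: eq_fsbigr => C /set_mem /= [_ [hC _]]; rewrite asboolT.
- by move=> C /= [? [? [? ?]]].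
- move=> C [/= [hC [hh hP]] hn] /=; case: asboolP => // hgh.
  by case: hn.
Qed.

Let oneE : groupoid_one = lambda_gen 1%g.
Proof.
congr (\sum_(C \in _) _); apply/seteqP; split=> C /= => [hC|[]//].
by split=> //; rewrite invg1; apply: component_vertex hC.
Qed.

Fact groupoid_mul1x : left_id groupoid_one (@groupoid_mul K G Delta).
Proof.
rewrite oneE; apply: (malg_linear_ext (f := groupoid_mul (lambda_gen 1%g))
  (g := @id KD)) => [||a]; [exact: groupoid_mul_linear_r|by []|].
have [[h1 h2] hV] := arrowP a; have e : val a = ((val a).1, (val a).2).
  by case: (val a).
rewrite -(basis_eltT K e) lambda_bas // mul1g asboolT //.
Qed.

Fact groupoid_mulx1 : right_id groupoid_one (@groupoid_mul K G Delta).
Proof.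
apply: (malg_linear_ext (f := (@groupoid_mul K G Delta)^~ groupoid_one)
  (g := @id KD)) => [||a]; [exact: groupoid_mul_linear_l|by []|].
have [[h1 h2] hV] := arrowP a; have e : val a = ((val a).1, (val a).2).
  by case: (val a).
rewrite -(basis_eltT K e) /groupoid_one mul_sumr; last exact: finE.
transitivity (\sum_(C \in vertices Delta) if `[< C = (val a).1 >]
  then bas (C, (val a).2) else 0).
  apply: eq_fsbigr => C /set_mem hC; rewrite basis_eltM //; last first.
    by rewrite invg1; exact: component_vertex hC.
  rewrite target1 mulg1; case: asboolP => [->|hn]; first by rewrite asboolT.
  by rewrite asboolF // => hC'; apply: hn.
by rewrite (sum_delta _ (fun C => bas (C, (val a).2))) asboolT.
Qed.

Fact groupoid_one_neq0 : groupoid_one != 0.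
Proof.
have [A hA hV] := component_nonempty Delta.
have [|a ea] := @basis_elt_ex _ Delta A 1%g hV; first by rewrite invg1.
apply/eqP => h; have := groupoid_mul1x << a >>.
rewrite h groupoid_mul0x => /esym /eqP.
by rewrite monalgU_eq0 oner_eq0.
Qed.

HB.instance Definition _ := GRing.Zmodule_isNzRing.Build KD
  (@groupoid_mulA K G Delta) groupoid_mul1x groupoid_mulx1
  (@groupoid_mulDl K G Delta) (@groupoid_mulDr K G Delta) groupoid_one_neq0.

Fact groupoid_scalerAl (c : K) x y : c *: (x * y) = (c *: x) * y.
Proof. by rewrite -[LHS]groupoid_mulZl. Qed.

HB.instance Definition _ :=
  GRing.Lmodule_isLalgebra.Build K KD groupoid_scalerAl.

Fact groupoid_scalerAr (c : K) x y : c *: (x * y) = x * (c *: y).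
Proof. by rewrite -[LHS]groupoid_mulZr. Qed.

HB.instance Definition _ :=
  GRing.Lalgebra_isAlgebra.Build K KD groupoid_scalerAr.

Lemma lambda_gen_par_rep : partial_representation lambda_gen.
Proof.
have M x y : x * y = groupoid_mul x y by [].
split=> [g h|g h|]; last by rewrite -oneE.
- rewrite -!mulrA !M !(lambda_genE h^-1%g) !lambdaE !mulgA mulgK.
  apply: eqE => C hC _; rewrite mulgV invgK invg1; split=> [[_ []]|[]] //.
  by split; [exact: component_vertex hC|].
- rewrite -!mulrA !M !(lambda_genE h) (lambda_genE (g * h)) !lambdaE !mulgA.
  rewrite mulVg mul1g; apply: eqE => C hC hh.
  by split=> [[h1 _]|[h1 _]].
Qed.

Definition lambda : par_algebra K G -> KD := par_lift lambda_gen_par_rep.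

HB.instance Definition _ := GRing.LRMorphism.on lambda.

Lemma lambda_par_gen g : lambda (par_gen K G g) =
  \sum_(C \in [set C | vertices Delta C /\ C g^-1%g]) basis_elt K Delta (C, g).
Proof. exact: par_lift_gen. Qed.

(* The left par_algebra-module KDelta; an alias, since groupoid_algebra is
   already a module over K. *)
Definition groupoid_module := KD.

HB.instance Definition _ := GRing.Zmodule.on groupoid_module.

Definition groupoid_act (u : par_algebra K G) (x : groupoid_module) :
  groupoid_module := lambda u * (x : KD).

Fact groupoid_actA u v x :
  groupoid_act u (groupoid_act v x) = groupoid_act (u * v) x.
Proof. by rewrite /groupoid_act rmorphM mulrA. Qed.

Fact groupoid_act1 : left_id 1 groupoid_act.
Proof. by move=> x; rewrite /groupoid_act rmorph1 mul1r. Qed.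

Fact groupoid_actDr : right_distributive groupoid_act +%R.
Proof. by move=> u x y; rewrite /groupoid_act -mulrDr. Qed.

Fact groupoid_actDl x : {morph groupoid_act^~ x : u v / u + v}.
Proof. by move=> u v; rewrite /groupoid_act rmorphD mulrDl. Qed.

HB.instance Definition _ :=
  GRing.Zmodule_isLmodule.Build (par_algebra K G) groupoid_module
    groupoid_actA groupoid_act1 groupoid_actDr groupoid_actDl.
End Lambda.

(* Main.v *)
Require Import Defs.
From HB Require Import structures.
From mathcomp Require Import all_boot all_order all_algebra.
From mathcomp Require Import boolp classical_sets functions cardinality.
From mathcomp Require Import fsbigop finmap monalg.

(** Write [g] for the generators of the partial group algebra and lambda for
its map [g] |-> g onto the group algebra KG. If KG were projective, the
surjective module map u |-> u . 1 = lambda u would have a section, and the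
image e of 1 under that section would satisfy

  lambda e = 1   and   [g] [g^-1] e = e for all g,

the second equation because [g] [g^-1] acts on KG as the identity. When G is
infinite no such e exists ([lambda_neq1_of_invariant]).

The reason is that e is a combination of finitely many words, so it only sees
a finite part of G. For a finite subset S of G containing 1, compressing the
left regular representation to the span of S gives a partial representation:
[g] sends the basis vector x of S to gx if gx is in S, and to 0 otherwise
([compression_par_rep]). Applied to the basis vector 1, a word [g_1] ... [g_k]
passes through the products of its suffixes. If S contains all of them, for
all words of e, then e acts on the vector 1 as lambda e does, truncated to S
([compression_lambda]); since lambda e = 1, the coefficient of e 1 at 1 is 1.
On the other hand, G being infinite, some g^-1 lies outside S, and then
[g] [g^-1] kills the coefficient at 1
([compression_idempotent_vanishes]). So [g] [g^-1] e = e forces 1 = 0. *)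

Set Implicit Arguments.
Unset Strict Implicit.
Unset Printing Implicit Defensive.

Import GRing.Theory.

Local Open Scope classical_set_scope.
Local Open Scope ring_scope.

(** * Finite subsets of a group and products of suffixes *)

Section Words.
Context (G : groupType).
Implicit Types (w r : seq G).

(** The positions visited from 1 when the letters of [w] act one after the
other by left multiplication, starting with the last letter. *)
Fixpoint suffix_products w : seq G :=
  if w is g :: w' then (\prod_(h <- w) h)%g :: suffix_products w' else [:: 1%g].

Lemma word_product_suffix w : (\prod_(h <- w) h)%g \in suffix_products w.
Proof. by case: w => [|g w] /=; rewrite ?big_nil mem_head. Qed.

(** Adjoining 1 makes the number of elements a successor, as needed for square
matrices indexed by them to form a nonzero ring. *)
Lemma injective_enumeration r :
  exists n (s : 'I_n.+1 -> G), injective s /\ codom s =i 1%g :: r.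
Proof.
pose t := (1%g : G) :: filter (predC1 1%g) (undup r).
exists (size (filter (predC1 (1%g : G)) (undup r))), (fun i => nth 1%g t i).
split=> [i j /eqP|x].
  rewrite nth_uniq ?ltn_ord //; first by move=> /eqP /val_inj.
  by rewrite /t /= mem_filter /= eqxx /= filter_uniq ?undup_uniq.
have -> : (x \in (1%g : G) :: r) = (x \in t).
  by rewrite !inE mem_filter /= mem_undup; case: eqP.
apply/codomP/idP => [[i ->]|hx]; first by rewrite mem_nth ?ltn_ord.
have lt := hx; rewrite -index_mem in lt.
by exists (Ordinal lt); rewrite /= nth_index.
Qed.
End Words.

(** * Compression of the regular representation to a finite subset *)

Section Compression.
Context (K : fieldType) (G : groupType) (n : nat) (s : 'I_n.+1 -> G).
Context (s_inj : injective s).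

Definition compression (g : G) : 'M[K]_n.+1 :=
  \matrix_(i, j) (s i == (g * s j)%g)%:R.

Definition point (x : G) : 'cV[K]_n.+1 := \col_i (s i == x)%:R.

Lemma point_out x : x \notin codom s -> point x = 0.
Proof.
move=> hx; apply/colP => i; rewrite !mxE; case: eqP => // e.
by rewrite -e codom_f in hx.
Qed.

Lemma compression_point g x :
  compression g *m point x = (x \in codom s)%:R *: point (g * x)%g.
Proof.
apply/colP => i; rewrite !mxE.
case: (boolP (x \in codom s)) => [/codomP [j ->]|hx].
  rewrite (bigD1 j) //= big1 ?addr0 => [|k kj]; rewrite !mxE.
    by rewrite eqxx mulr1 mul1r.
  by rewrite (inj_eq s_inj) (negbTE kj) mulr0.
rewrite big1 ?mul0r // => j _; rewrite !mxE.
case: (s j =P x) => [e|_]; last exact: mulr0.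
by rewrite -e codom_f in hx.
Qed.

Lemma point_ext (A B : 'M[K]_n.+1) :
  (forall x, x \in codom s -> A *m point x = B *m point x) -> A = B.
Proof.
move=> h; apply/matrixP => i j.
have e : point (s j) = delta_mx j 0.
  by apply/colP => k; rewrite !mxE andbT (inj_eq s_inj).
have := h (s j) (codom_f _ _); rewrite e -!colE => /colP /(_ i).
by rewrite !mxE.
Qed.

(** In either relation, both sides move a point x of the subset to the same
place. The left side makes one more membership test: in the first relation on
returning to x, which is in the subset, in the second at hx, which is also the
place where both sides end. *)
Lemma compression_par_rep : partial_representation compression.
Proof.
split=> [g h|g h|]; apply: point_ext => x hx; rewrite -?mulmxE -?mulmxA.
- rewrite !(compression_point, =^~ scalemxAr) hx !scale1r -!mulgA !mulVKg.
  by rewrite hx scale1r.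
- rewrite !(compression_point, =^~ scalemxAr) hx !scale1r -!mulgA !mulKg.
  by have [_|/point_out ->] := boolP ((h * x)%g \in _);
    rewrite ?scale1r ?scaler0.
- by rewrite compression_point hx scale1r mul1g mul1mx.
Qed.

Lemma compression_word (w : {fmonom G}) :
    {subset suffix_products w <= codom s} ->
  word_eval compression w *m point 1%g = point (\prod_(g <- (w : seq G)) g)%g.
Proof.
rewrite /word_eval; elim: (w : seq G) => [|g r IH] /= hr.
  by rewrite !big_nil mul1mx.
have hr' : {subset suffix_products r <= codom s}.
  by move=> x hx; apply: hr; rewrite inE hx orbT.
rewrite !big_cons -mulmxE -mulmxA IH // compression_point.
by rewrite hr' ?word_product_suffix // scale1r.
Qed.

(** To end at 1, the letter g must start from g^-1, which has been cut off. *)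
Lemma compression_idempotent_vanishes (i : 'I_n.+1) (g : G) (v : 'cV[K]_n.+1) :
    s i = 1%g -> g^-1%g \notin codom s ->
  (compression g *m compression g^-1 *m v) i 0 = 0.
Proof.
move=> s1 hg; rewrite -mulmxA mxE big1 // => j _; rewrite mxE s1.
case: eqP => [e|_]; last exact: mul0r.
case/negP: hg; have -> : (g^-1 = s j)%g; last exact: codom_f.
by apply: (mulgI g); rewrite mulgV.
Qed.
End Compression.

(** * The component with unique vertex G *)

Lemma monalgU_scale (R : nzRingType) (T : choiceType) (c : R) (k : T) :
  c *: << k >> = << c *g k >> :> {malg R[T]}.
Proof. by apply/malgP => l; rewrite mcoeffZ !mcoeffU mulrnAr mulr1. Qed.

Lemma free_evalE (K : fieldType) (G : groupType) (A : algType K)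
    (phi : G -> A) (x : free_algebra K G) :
  free_eval phi x = \sum_(w <- msupp x) x@_w *: word_eval phi w.
Proof.
by rewrite /free_eval mmapE; apply: eq_bigr => w _; rewrite mulr_algl.
Qed.

Section GroupComponent.
Context (K : fieldType) (G : groupType) (Delta : fin_component G).
Context (hDelta : vertices Delta = [set [set: G]]).

Local Notation KD := (groupoid_algebra K Delta).
Local Notation bas g := (basis_elt K Delta ([set: G], g)).
Local Notation lam := (@lambda K G Delta).

Lemma lambda_group_gen g : lam (par_gen K G g) = bas g.
Proof.
rewrite lambda_par_gen hDelta.
rewrite (_ : [set C | _] = [set [set: G]]) ?fsbig_set1 //.
by apply/seteqP; split=> [C [] |C ->].
Qed.

Lemma group_basisM g h : (bas g : KD) * bas h = bas (g * h)%g.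
Proof.
rewrite -[LHS]/(groupoid_mul _ _) basis_eltM ?hDelta // asboolT //.
by apply/seteqP; split=> // x _; apply/targetE.
Qed.

Lemma group_basis1 : bas 1%g = 1 :> KD.
Proof.
have [_ _ h1] := par_gen_par_rep K G.
by rewrite -lambda_group_gen h1; exact: (rmorph1 lam).
Qed.

Lemma group_arrow (a : arrow Delta) : val a = ([set: G], (val a).2).
Proof.
by have [_] := arrowP a; rewrite hDelta /source /= => <-; case: (val a).
Qed.

Lemma mcoeff_group_basis (a : arrow Delta) g :
  (bas g : KD)@_a = (g == (val a).2)%:R.
Proof.
have [|b eb] := @basis_elt_ex _ Delta [set: G] g _ I; first by rewrite hDelta.
rewrite (basis_eltT _ eb) mcoeffU -val_eqE eb group_arrow /=.
by rewrite xpair_eqE eqxx.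
Qed.

Lemma lambda_surjective (y : KD) : exists u, lam u = y.
Proof.
exists (\sum_(a <- msupp y) y@_a *: par_gen K G (val a).2).
rewrite raddf_sum [RHS]monalgE; apply: eq_bigr => a _.
transitivity (y@_a *: lam (par_gen K G (val a).2)).
  exact: par_lift_scalable.
rewrite lambda_group_gen (basis_eltT _ (group_arrow a)).
exact: monalgU_scale.
Qed.

Lemma word_eval_lambda (w : {fmonom G}) :
  word_eval (lambda_gen K Delta) w = bas (\prod_(g <- (w : seq G)) g)%g.
Proof.
rewrite /word_eval; elim: (w : seq G) => [|g r IH].
  by rewrite !big_nil group_basis1.
rewrite !big_cons IH -group_basisM -lambda_group_gen.
by rewrite [lam _]par_lift_gen.
Qed.

(** The compression to a finite subset agrees with the full regular
representation on the vector 1, as long as no word of [x] leaves the subset on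
its way. *)
Lemma compression_lambda n (s : 'I_n.+1 -> G) (x : free_algebra K G)
    (i : 'I_n.+1) (a : arrow Delta) :
    injective s ->
    {in msupp x, forall w : {fmonom G}, {subset suffix_products w <= codom s}} ->
    (val a).2 = s i ->
  (free_eval (compression K s) x *m point K s 1%g) i 0 = (lam (par_pi x))@_a.
Proof.
move=> s_inj hx ha; rewrite /lambda par_lift_pi !free_evalE mulmx_suml.
rewrite summxE raddf_sum big_seq [RHS]big_seq; apply: eq_bigr => w hw.
rewrite -scalemxAl compression_word //; last exact: hx.
transitivity (x@_w * (word_eval (lambda_gen K Delta) w)@_a); last first.
  by symmetry; exact: mcoeffZ.
by rewrite !mxE word_eval_lambda mcoeff_group_basis ha eq_sym.
Qed.

(** The subset S consists of all suffix products of the words of a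
representative [x] of [e]. It is finite, so it misses some g^-1, and then the
coefficient at 1 of [e] applied to the vector 1 is both 1 and 0. *)
Lemma lambda_neq1_of_invariant (e : par_algebra K G) :
    infinite_set [set: G] ->
    (forall g, par_gen K G g * par_gen K G g^-1 * e = e) ->
  lam e <> 1.
Proof.
move=> hG he le1; have [x ex] := par_pi_surj e.
pose r := flatten [seq suffix_products (w : seq G) | w : {fmonom G} <- msupp x].
have [n [s [s_inj hs]]] := injective_enumeration r.
have [i s1] : exists i, s i = 1%g.
  by have /codomP [i ->] : 1%g \in codom s; [rewrite hs mem_head | exists i].
have [g hg] : exists g, g^-1%g \notin codom s.
  apply: contrapT => /forallNP h; apply: hG.
  apply: sub_finite_set (finite_seq (codom s)) => g _ /=.
  by have /negP := h g^-1%g; rewrite invgK negbK.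
have [|a ea] := @basis_elt_ex _ Delta [set: G] 1%g _ I; first by rewrite hDelta.
have hx : {in msupp x, forall w : {fmonom G},
    {subset suffix_products w <= codom s}}.
  move=> w hw y hy; rewrite hs inE; apply/orP; right.
  by apply/flatten_mapP; exists w.
have := compression_lambda (i := i) (a := a) s_inj hx.
rewrite ea s1 -ex le1 -group_basis1 mcoeff_group_basis ea eqxx => /(_ erefl).
set hcomp := compression_par_rep K s_inj.
have rhoM := (par_lift_monoid_morphism hcomp).2.
rewrite -(par_lift_pi hcomp) -ex -(he g) !rhoM !par_lift_gen.
rewrite -!mulmxE -mulmxA compression_idempotent_vanishes //.
by move/esym/eqP; rewrite oner_eq0.
Qed.
End GroupComponent.

Theorem proposition6p2 (K : fieldType) (G : groupType)
    (hG : infinite_set [set: G])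
    (Delta : fin_component G) (hDelta : vertices Delta = [set [set: G]]) :
  ~ @projective (par_algebra K G) (groupoid_module K Delta).
Proof.
move=> proj.
pose one : groupoid_module K Delta := (1 : groupoid_algebra K Delta).
(* The orbit map of 1, from the regular module; projectivity makes it split. *)
pose p (u : (par_algebra K G)^o) : groupoid_module K Delta :=
  (u : par_algebra K G) *: one.
have p_lin : linear p by move=> c u v; rewrite /p scalerDl scalerA.
pose pM := GRing.isLinear.Build _ _ _ _ p p_lin.
pose pL : {linear (par_algebra K G)^o -> groupoid_module K Delta} :=
  HB.pack p pM.
have pE u : p u = lambda Delta u by exact: mulr1.
have [|s sK] := proj _ _ pL idfun.
  by move=> y; have [u <-] := lambda_surjective hDelta y; exists u; exact: pE.
apply: (lambda_neq1_of_invariant (e := s one) hDelta hG); last first.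
  by rewrite -pE; exact: sK.
move=> g; rewrite -[LHS]/(_ *: s one) -linearZ; congr (s _).
rewrite -[LHS]/(lambda Delta _ * (1 : groupoid_algebra K Delta)) mulr1.
by rewrite rmorphM /= !lambda_group_gen // group_basisM // mulgV group_basis1.
Qed.
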